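(* For every infinite $A\subseteq\mathbb{Q}$, the following are equivalent: (i) $A$ is scattered (with the order inherited from $\mathbb{Q}$). (ii) $WO\upharpoonright A$ belongs to $\mathcal{B}$. (iii) $WO\upharpoonright A$ is Borel. (iv) $WO\not\hookrightarrow WO\upharpoonright A$.
   Context: An ideal over a countable set $X$ is a family of subsets of $X$ that contains every finite subset of $X$ and is closed under taking subsets and finite unions ($\mathcal{P}(X)$ is allowed). Subsets are identified with characteristic functions, so an ideal is a subset of $2^X$, and ''Borel'' refers to this subset. For ideals $I$ on $X$ and $J$ on $Y$: $I\cong J$ (isomorphic) if there is a bijection $f:X\to Y$ such that $E\in I$ iff $f[E]\in J$; $I\hookrightarrow J$ if there is an injection $f:X\to Y$ such that, for $E\subseteq X$, $E\in I$ iff $f[E]\in J$. $I\upharpoonright K$ is the ideal on $K$ of all subsets of $K$ belonging to $I$. The orthogonal of $I$ is $I^\perp=\{B\subseteq X: A\cap B\text{ is finite for all }A\in I\}$. Direct sum: given finitely or countably many ideals $I_n$ on countably infinite sets $X_n$, take a partition $\{K_n\}$ of $\mathbb{N}$ and an isomorphic copy $I_n'$ of $I_n$ on $K_n$; then $A\in\bigoplus_n I_n$ iff $A\cap K_n\in I_n'$ for all $n$ (well defined up to isomorphism). $\mathcal{B}$ is the smallest collection of ideals on $\mathbb{N}$ containing the ideal of finite sets and closed under countable (including finite) direct sums and orthogonal; an ideal over a countable set is said to belong to $\mathcal{B}$ if it is isomorphic to an ideal in $\mathcal{B}$. $WO=WO(\mathbb{Q})$ is the ideal on $\mathbb{Q}$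 of subsets that are well founded (well ordered) under the usual order. A linear order is scattered if it does not contain an order-isomorphic copy of $\mathbb{Q}$. *)

(* Defs.v *)
From mathcomp Require Import all_boot all_order all_algebra.
From mathcomp Require Import all_classical all_reals all_analysis.
Set Implicit Arguments.
Unset Strict Implicit.
Unset Printing Implicit Defensive.
Import Order.TTheory GRing.Theory Num.Theory.
Local Open Scope classical_set_scope.

(* An ideal on a subset K of X is an ideal on the (countable) type of elements
   of K, into which K is coerced. *)
Record ideal (X : countType) := Ideal {
  ideal_sets :> set X -> Prop ;
  ideal_finite : forall A, finite_set A -> ideal_sets A ;
  ideal_subset : forall A B, A `<=` B -> ideal_sets B -> ideal_sets A ;
  ideal_setU : forall A B, ideal_sets A -> ideal_sets B -> ideal_sets (A `|` B)
}.

Definition isomorphic (X Y : countType) (I : ideal X) (J : ideal Y) : Prop :=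
  exists2 f : X -> Y, bijective f & forall E : set X, I E <-> J (f @` E).

Definition embeds (X Y : countType) (I : ideal X) (J : ideal Y) : Prop :=
  exists2 f : X -> Y, injective f & forall E : set X, I E <-> J (f @` E).

(* The prod_topology on X -> bool is that of 2^X, bool being discrete. *)
Definition borel (X : countType) (I : ideal X) : Prop :=
  <<s [set U : set {ptws X -> bool} | open U] >>
    [set chi : {ptws X -> bool} | I [set x | chi x]].

Program Definition fin_ideal (X : countType) : ideal X :=
  @Ideal X [set A | finite_set A] _ _ _.
Next Obligation. by []. Qed.
Next Obligation. by move=> X A B; exact: sub_finite_set. Qed.
Next Obligation. by move=> X A B /= fA fB; rewrite finite_setU. Qed.

Program Definition restr_ideal (X : countType) (I : ideal X) (K : set X) :
  ideal K := @Ideal K [set E : set K | I (val @` E)] _ _ _.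
Next Obligation.
by move=> X I K A fA; apply/ideal_finite/finite_image.
Qed.
Next Obligation.
by move=> X I K A B AB; apply/ideal_subset/image_subset.
Qed.
Next Obligation.
by move=> X I K A B IA IB; rewrite /= image_setU; exact: ideal_setU.
Qed.

Program Definition orth_ideal (X : countType) (I : ideal X) : ideal X :=
  @Ideal X [set B | forall A, I A -> finite_set (A `&` B)] _ _ _.
Next Obligation. by move=> X I B fB A _; exact: finite_setIr. Qed.
Next Obligation.
move=> X I B C BC oC A IA; apply: sub_finite_set (oC A IA).
exact: setIS.
Qed.
Next Obligation.
move=> X I B C oB oC A IA; rewrite setIUr finite_setU.
by split; [exact: oB|exact: oC].
Qed.

(* J is a direct sum of the ideals I n on nat, n ranging over the nonempty,
   finite or infinite, index set D; val @^-1` A is the trace of A on K n. *)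
Definition direct_sum (D : set nat) (I : nat -> ideal nat) (J : ideal nat) :
    Prop :=
  exists (K : nat -> set nat) (I' : forall n, ideal (K n)),
    [/\ partition D K [set: nat],
        forall n, D n -> isomorphic (I n) (I' n) &
        forall A : set nat, J A <-> forall n, D n -> I' n (val @^-1` A)].

Inductive calB : ideal nat -> Prop :=
| calB_fin : calB (fin_ideal nat)
| calB_sum (D : set nat) (I : nat -> ideal nat) (J : ideal nat) :
    (forall n, D n -> calB (I n)) -> direct_sum D I J -> calB J
| calB_orth (I : ideal nat) : calB I -> calB (orth_ideal I).

Definition belongs_to_calB (X : countType) (I : ideal X) : Prop :=
  exists2 J : ideal nat, calB J & isomorphic I J.

Definition well_ordered d (L : orderType d) (A : set L) : Prop :=
  forall B, B `<=` A -> B !=set0 -> exists2 m, B m & lbound B m.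

Program Definition WO : ideal rat :=
  @Ideal rat [set A : set rat | well_ordered A] _ _ _.
Next Obligation.
move=> A fA B BA [b Bb].
have fB : finite_set B by exact: sub_finite_set fA.
have /finite_seqP[s Es] := fB.
have bs : b \in s by move: Bb; rewrite Es.
have [m ms mle] : exists2 m, m \in s & {in s, forall x, (m <= x)%O}.
  elim: s b bs {Bb Es} => [//|a s IH] b _.
  case: s IH => [|c s] IH.
    by exists a; rewrite ?mem_head// => x; rewrite inE => /eqP ->.
  have [|m ms mle] := IH c; first exact: mem_head.
  have [am|/ltW ma] := leP a m.
    exists a; first exact: mem_head.
    by move=> x; rewrite in_cons => /orP[/eqP ->//|/mle]; exact: le_trans.
  exists m; first by rewrite in_cons ms orbT.
  by move=> x; rewrite in_cons => /orP[/eqP ->//|/mle].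
by exists m; rewrite Es//= => x /mle.
Qed.
Next Obligation. by move=> A B AB wB C CA; apply: wB; exact: subset_trans AB. Qed.
Next Obligation.
move=> A B wA wB C CAB C0.
have [[a CAa]|nA] := pselect ((C `&` A) !=set0); last first.
  apply: wB => // x Cx; case: (CAB x Cx) => // Ax.
  by case: nA; exists x.
have [[b CBb]|nB] := pselect ((C `&` B) !=set0); last first.
  apply: wA => // x Cx; case: (CAB x Cx) => // Bx.
  by case: nB; exists x.
have [||m [Cm _] lm] := wA (C `&` A); [exact: subIsetr|by exists a|].
have [||n [Cn _] ln] := wB (C `&` B); [exact: subIsetr|by exists b|].
exists (Order.min m n); first by case: leP.
move=> x Cx; rewrite ge_min; apply/orP.
by case: (CAB x Cx) => ?; [left; apply: lm|right; apply: ln].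
Qed.

Definition scattered d (L : orderType d) (A : set L) : Prop :=
  ~ exists2 f : rat -> L, range f `<=` A & {mono f : x y / (x <= y)%O}.

(* Main.v *)
Require Import Defs.
From mathcomp Require Import all_boot all_order all_algebra.
From mathcomp Require Import all_classical all_reals all_analysis.
From mathcomp Require Import lra.
Set Implicit Arguments.
Unset Strict Implicit.
Unset Printing Implicit Defensive.
Import Order.TTheory GRing.Theory Num.Theory.
Local Open Scope classical_set_scope.

(* (i) => (ii), after Hausdorff: if A is scattered, then WO restricted to every
   infinite subset of A is in B.  This property of a set is preserved by finite
   unions; by increasing sums, along which WO is a direct sum; and by
   decreasing sums, along which WO is the orthogonal of a direct sum.  If it
   failed for A, then "a < b and it fails for A /\ [a, b]" would be a dense
   relation on A, and Q would embed in A.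
   (ii) => (iii): the orthogonal of a direct sum is described by the orthogonals
   of the summands, so by induction every J in B is equal to its double
   orthogonal, and both J and its orthogonal are Borel.
   (iii) => (iv): Borel sets are analytic, whereas WO is not, by
   diagonalization over Kleene-Brouwer orders.
   (iv) => (i): a copy of Q inside A is a copy of WO inside its restriction. *)

(** * Pulling back ideals; sums along a map *)

Lemma ideal_ext (X : countType) (I J : ideal X) : (forall E, I E <-> J E) -> I = J.
Proof.
case: I J => [I I1 I2 I3] [J J1 J2 J3] /= IJ.
have EIJ : I = J by apply/funext => E; apply/propext.
by rewrite -{}EIJ in J1 J2 J3 IJ *; congr Ideal; exact: Prop_irrelevance.
Qed.

(** For injective [f], a copy on [X] of the restriction of [I] to the range of [f], made without a
    subtype. *)
Program Definition pull_ideal (X Y : countType) (f : X -> Y) (I : ideal Y) :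
  ideal X := @Ideal X [set E | I (f @` E)] _ _ _.
Next Obligation.
by move=> X Y f I A fA; apply/ideal_finite/finite_image.
Qed.
Next Obligation.
by move=> X Y f I A B AB; apply/ideal_subset/image_subset.
Qed.
Next Obligation.
by move=> X Y f I A B IA IB; rewrite /= image_setU; exact: ideal_setU.
Qed.

Lemma infinite_enum (X : countType) (K : set X) : infinite_set K ->
  exists2 f : nat -> X, injective f & range f = K.
Proof.
move=> Kinf.
have /card_set_bijP[g [_ gI gK]] := eq_card_nat (countableP K) Kinf.
have /choice[f fP] : forall n, exists x, K x /\ g x = n.
  by move=> n; have [x Kx gx] := gK n I; exists x.
exists f => [m n mn|]; first by rewrite -(fP m).2 -(fP n).2 mn.
apply/seteqP; split=> [_ [n _ <-]|x Kx]; first exact: (fP n).1.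
by exists (g x) => //; apply: gI; rewrite ?inE ?(fP _).2//; exact: (fP _).1.
Qed.

Lemma finite_image_inj (T U : Type) (f : T -> U) (A : set T) :
  {in A &, injective f} -> finite_set (f @` A) -> finite_set A.
Proof. by move=> /inj_card_eq/eq_finite_set ->. Qed.

Lemma infinite_image (T U : Type) (f : T -> U) (A : set T) : injective f ->
  infinite_set A -> infinite_set (f @` A).
Proof. by move=> fI Ai fA; apply: Ai; apply: finite_image_inj fA => x y _ _ /fI. Qed.

Section Pull.
Variables (X Y : countType).
Implicit Types (f : X -> Y) (I : ideal Y).

Lemma pull_preimage f I (A : set Y) :
  pull_ideal f I (f @^-1` A) <-> I (A `&` range f).
Proof.
rewrite /=; have -> // : f @` (f @^-1` A) = A `&` range f.
apply/seteqP; split=> [_ [x Ax <-]|y [Ay [x _ xy]]]; first by split=> //; exists x.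
by exists x => //=; rewrite xy.
Qed.

(** A set inside the range of [f] meets a member of [I] only in its trace on that range, and
    injectivity carries finiteness back from images. *)
Lemma pull_orth f I : injective f ->
  pull_ideal f (orth_ideal I) = orth_ideal (pull_ideal f I).
Proof.
move=> fI; apply: ideal_ext => E; split => [EI A fA|EI A IA].
  have /EI : I (f @` A) by [].
  move=> fAE; apply: (@finite_image_inj _ _ f); first by move=> x y _ _ /fI.
  by apply: sub_finite_set fAE => _ [x [Ax Ex] <-]; split; exists x.
have /EI/(finite_image f) : pull_ideal f I (f @^-1` A).
  by apply: ideal_subset IA => y [x ? <-].
apply: sub_finite_set => y [Ay [x Ex xy]]; exists x => //.
by split => //=; rewrite xy.
Qed.

End Pull.

Lemma orthK_sub (X : countType) (I : ideal X) E : I E -> orth_ideal (orth_ideal I) E.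
Proof. by move=> IE A /= /(_ _ IE); rewrite setIC. Qed.

(** * Sums of ideals along the fibres of a map, and their orthogonals *)

Section Sums.
Variables (X : countType).
Implicit Types (I : ideal X) (q : X -> nat).

(** The summands sit on the fibres of [q]; unlike in [direct_sum], a fibre may be empty or
    finite. *)
Definition sum_along I q := forall E, I E <-> forall n, I (E `&` q @^-1` [set n]).

Definition bounded_on q (E : set X) := exists N, forall x, E x -> (q x <= N)%N.

Definition bounded_sum_along I q := forall E,
  I E <-> (forall n, I (E `&` q @^-1` [set n])) /\ bounded_on q E.

(** An unbounded set meets infinitely many fibres; [T] takes one point, chosen by [c], from each
    fibre that is met. *)
Lemma selector q (E : set X) : ~ bounded_on q E ->
  exists T, [/\ T `<=` E, infinite_set T &
    forall x y, T x -> T y -> q x = q y -> x = y].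
Proof.
move=> Eq; pose c n := xget None [set o | exists2 x, o = Some x & E x /\ q x = n].
have cP x : E x -> exists2 y, c (q x) = Some y & E y /\ q y = q x.
  move=> Ex; rewrite /c; case: xgetP => [r _ //|] /(_ (Some x)) /=.
  by case; exists x.
exists [set x | c (q x) = Some x]; split.
- move=> x /=; rewrite /c; case: xgetP => [r _ [y -> [Ey _]]|_ //].
  by move=> [<-].
- move=> fT; apply: Eq.
  have /finite_seqP[s Es] := finite_image q fT.
  exists (\max_(i <- s) i) => x /cP[y cy [Ey qy]].
  apply: leq_bigmax_seq => //.
  have : (q @` [set x | c (q x) = Some x]) (q x).
    by exists y => //=; rewrite qy.
  by rewrite Es.
- by move=> x y /= cx cy qxy; move: cx; rewrite qxy cy => -[].
Qed.

Lemma finite_selector q (T : set X) N :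
  (forall x y, T x -> T y -> q x = q y -> x = y) ->
  (forall x, T x -> (q x <= N)%N) -> finite_set T.
Proof.
move=> Tq TN; apply: (@finite_image_inj _ _ q).
  by move=> x y; rewrite !inE; exact: Tq.
apply: sub_finite_set (finite_II N.+1) => n [x /TN xN <-] /=.
by rewrite ltnS.
Qed.

Lemma finite_bounded_fibers q (A : set X) : bounded_on q A ->
  (forall n, finite_set (A `&` q @^-1` [set n])) -> finite_set A.
Proof.
move=> [N AN] Af.
apply: (@sub_finite_set _ _ (\bigcup_(n in `I_N.+1) (A `&` q @^-1` [set n]))).
  by move=> x Ax; exists (q x) => //=; rewrite ltnS AN.
exact: bigcup_finite.
Qed.

(** Sets with at most one point in each fibre lie in [I], so a set orthogonal to [I] cannot meet
    infinitely many fibres. *)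
Lemma orth_sum I q : sum_along I q -> bounded_sum_along (orth_ideal I) q.
Proof.
move=> Iq E; split => [oE|[oE [N EN]] A IA].
  split=> [n|]; first by apply: ideal_subset oE; exact: subIsetl.
  apply: contrapT => /selector[T [TE Tinf Tq]]; apply: Tinf.
  have IT : I T.
    apply/Iq => n; apply: ideal_finite; apply: (@finite_selector q _ n).
      by move=> x y [Tx _] [Ty _]; exact: Tq.
    by move=> x [_ /= ->].
  by have := oE _ IT; rewrite setIidl.
apply: (@finite_bounded_fibers q).
  by exists N => x [_ /EN].
by move=> n; rewrite -setIA; exact: oE.
Qed.

Lemma orth_bounded_sum I q : bounded_sum_along I q -> sum_along (orth_ideal I) q.
Proof.
move=> Iq E; split => [oE n|oE A IA].
  by apply: ideal_subset oE; exact: subIsetl.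
have [_ [N AN]] := (Iq A).1 IA.
apply: (@finite_bounded_fibers q).
  by exists N => x [/AN].
by move=> n; rewrite -setIA; exact: oE.
Qed.

End Sums.

(** * Restrictions to infinite sets that belong to [calB] *)

Lemma inj_surj_bijective (T U : Type) (f : T -> U) :
  injective f -> (forall y, exists x, f x = y) -> bijective f.
Proof.
by move=> fI /choice[g gK]; exists g => // x; apply: fI.
Qed.

Lemma enum_onto (X : countType) (f : nat -> X) (K : set X) :
  injective f -> range f = K ->
  exists2 h : nat -> K, bijective h & forall n, val (h n) = f n.
Proof.
move=> fI fK.
have fKn n : f n \in K by rewrite inE -fK; exists n.
exists (fun n => exist _ (f n) (fKn n)) => //.
apply: inj_surj_bijective => [m n /(congr1 val)/fI//|[y yK]].
have := yK; rewrite inE -{1}fK => -[n _ fny].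
by exists n; apply: val_inj.
Qed.

(** An injective enumeration of [K] moves the restriction to [nat], where [calB] lives; it also
    forces [K] to be infinite. *)
Definition in_calB (X : countType) (I : ideal X) (K : set X) :=
  exists f : nat -> X, [/\ injective f, range f = K & calB (pull_ideal f I)].

Lemma in_calB_belongs (X : countType) (I : ideal X) (K : set X) :
  in_calB I K -> belongs_to_calB (restr_ideal I K).
Proof.
move=> [f [fI fK Bf]]; exists (pull_ideal f I) => //.
have [h [g hK gK] hf] := enum_onto fI fK.
exists g; first by exists h.
move=> E /=; suff -> : f @` (g @` E) = val @` E by [].
rewrite image_comp; apply: eq_imagel => x Ex /=.
by rewrite -hf gK.
Qed.

Lemma calB_sum_along_nonempty (J : ideal nat) (q : nat -> nat) : sum_along J q ->
  (forall n, q @^-1` [set n] !=set0 -> in_calB J (q @^-1` [set n])) -> calB J.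
Proof.
move=> Jq Bq.
have /choice[f fP] : forall n, exists f : nat -> nat, q @^-1` [set n] !=set0 ->
    [/\ injective f, range f = q @^-1` [set n] & calB (pull_ideal f J)].
  move=> n; have [ne|] := pselect (q @^-1` [set n] !=set0).
    by have [f fP] := Bq _ ne; exists f.
  by exists id.
have rq n : range q n -> q @^-1` [set n] !=set0 by move=> [x _ <-]; exists x.
(* Indexing by [range q] drops the empty fibres, which a partition excludes. *)
apply: (@calB_sum (range q) (fun n => pull_ideal (f n) J)).
  by move=> n /rq nq; have [] := fP n nq.
exists (fun n => q @^-1` [set n]), (fun n => restr_ideal J _); split.
- split=> [||n /rq//].
    by apply/seteqP; split=> // x _; exists (q x) => //; exists x.
  apply/trivIsetP => i j _ _ /eqP ij; apply/seteqP; split=> // x [/= qi qj].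
  by apply: ij; rewrite -qi -qj.
- move=> n /rq nq; have [fI fK _] := fP n nq.
  have [h hB hf] := enum_onto fI fK.
  exists h => // E /=; suff -> : f n @` E = val @` (h @` E) by [].
  by rewrite image_comp; apply: eq_imagel => x _; rewrite -hf.
- have vE A n : val @` (val @^-1` A : set (q @^-1` [set n])) = A `&` q @^-1` [set n].
    apply/seteqP; split=> [_ [[x /= xq] /= Ax <-]|x [Ax qx]].
      by split=> //; rewrite inE in xq.
    by exists (exist _ x (mem_set qx)).
  move=> A; rewrite Jq; split=> [JA n _ /=|JA n]; first by rewrite vE.
  have [[x qx]|n0] := pselect (q @^-1` [set n] !=set0).
    by rewrite -vE; apply: JA; exists x.
  apply: ideal_finite; rewrite (_ : _ `&` _ = set0) //.
  by apply/seteqP; split=> // x [_ qx]; apply: n0; exists x.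
Qed.

Lemma in_calB_pull (X Y : countType) (I : ideal Y) (f : X -> Y) (M : set X) :
  injective f -> in_calB I (f @` M) -> in_calB (pull_ideal f I) M.
Proof.
move=> fI [e [eI eM Be]].
have /choice[g gP] : forall n, exists x, M x /\ f x = e n.
  move=> n; have : range e (e n) by exists n.
  by rewrite eM => -[x Mx fx]; exists x.
exists g; split.
- by move=> m n mn; apply: eI; rewrite -(gP m).2 -(gP n).2 mn.
- apply/seteqP; split=> [_ [n _ <-]|x Mx]; first exact: (gP n).1.
  have : (f @` M) (f x) by exists x.
  by rewrite -eM => -[n _ en]; exists n => //; apply: fI; rewrite (gP n).2.
- suff -> : pull_ideal g (pull_ideal f I) = pull_ideal e I by [].
  apply: ideal_ext => E /=; rewrite image_comp (_ : (f \o g) @` E = e @` E) //.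
  by apply: eq_imagel => n _ /=; rewrite (gP n).2.
Qed.

Lemma in_calB_orth (X : countType) (I : ideal X) (K : set X) :
  in_calB I K -> in_calB (orth_ideal I) K.
Proof.
by move=> [f [fI fK Bf]]; exists f; split=> //; rewrite pull_orth//; exact: calB_orth.
Qed.

(** The restriction is then the full power set, which is the orthogonal of the ideal of finite
    sets. *)
Lemma in_calB_all (X : countType) (I : ideal X) (K : set X) :
  infinite_set K -> I K -> in_calB I K.
Proof.
move=> /infinite_enum[f fI fK] IK; exists f; split=> //.
suff -> : pull_ideal f I = orth_ideal (fin_ideal nat) by do 2!constructor.
apply: ideal_ext => E; split=> [_ A fA|_]; first exact: finite_setIl.
by apply: ideal_subset IK; rewrite -fK; exact: image_subset.
Qed.

Lemma ideal_no_infinite (X : countType) (I : ideal X) (F : set X) : finite_set F ->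
  ~ (exists S, [/\ I S, infinite_set S & S `<=` ~` F]) ->
  forall E, I E <-> finite_set E.
Proof.
move=> Ff nI E; split; last exact: ideal_finite.
move=> IE; apply: contrapT => Einf; apply: nI; exists (E `\` F); split.
- by apply: ideal_subset IE; exact: subDsetl.
- exact: infinite_setD.
- by move=> x [].
Qed.

(* Hilbert's hotel: if I has an infinite member S, move F into S; otherwise I
   is the ideal of finite sets. *)
Lemma absorb_finite (I : ideal nat) (F : set nat) : finite_set F ->
  exists g, [/\ injective g, range g = ~` F & pull_ideal g I = I].
Proof.
move=> Ff; have [[S [IS Sinf SF]]|/(ideal_no_infinite Ff) Ifin] :=
  pselect (exists S, [/\ I S, infinite_set S & S `<=` ~` F]); last first.
  have [|g gI gF] := @infinite_enum nat (~` F).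
    by apply: cofinite_set_infinite; [exact: infinite_nat|rewrite setCK].
  exists g; split=> //; apply: ideal_ext => E.
  rewrite /= !Ifin; split=> [|/(finite_image g)//].
  by apply: finite_image_inj => x y _ _ /gI.
have [e eI eS] := infinite_enum Sinf.
have [|d dI dS] := @infinite_enum nat (S `|` F).
  by rewrite finite_setU => -[].
have /choice[c cP] : forall x, exists n, (S `|` F) x -> d n = x.
  move=> x; have [|?] := pselect ((S `|` F) x); last by exists 0%N.
  by rewrite -dS => -[n _ dn]; exists n.
have Se n : S (e n) by rewrite -eS; exists n.
have SFd n : (S `|` F) (d n) by rewrite -dS; exists n.
(* [g] maps the union of [S] and [F] bijectively onto [S], since [c] inverts the enumeration [d] of
   the union and [e] enumerates [S]; it fixes all other points. *)
pose g x := if x \in S `|` F then e (c x) else x.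
have gSF x : (S `|` F) x -> g x = e (c x) by move=> xSF; rewrite /g mem_set.
have gN x : ~ (S `|` F) x -> g x = x by move=> xSF; rewrite /g memNset.
exists g; split.
- move=> x y.
  have [x1|x1] := pselect ((S `|` F) x); have [y1|y1] := pselect ((S `|` F) y).
  + by rewrite !gSF// => /eI xy; rewrite -(cP x)// -(cP y)// xy.
  + by rewrite gSF// gN// => xy; case: y1; left; rewrite -xy.
  + by rewrite gN// gSF// => xy; case: x1; left; rewrite xy.
  + by rewrite !gN.
- apply/seteqP; split=> [_ [x _ <-]|x Fx].
    have [x1|x1] := pselect ((S `|` F) x); first by rewrite gSF//; apply: SF.
    by rewrite gN// => Fx; apply: x1; right.
  have [x1|x1] := pselect (S x); last by exists x => //; rewrite gN// => -[].
  move: x1; rewrite -eS => -[n _ <-]; exists (d n) => //.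
  by rewrite gSF//; congr e; apply: dI; exact: cP.
(* A set and its image under [g] differ only inside this union, which is a member of [I]. *)
- have ISF : I (S `|` F) by apply: ideal_setU => //; exact: ideal_finite.
  apply: ideal_ext => E; split=> [gE|IE].
  + apply: (@ideal_subset _ _ _ (g @` E `|` (S `|` F))); last exact: ideal_setU.
    move=> x Ex; have [|x1] := pselect ((S `|` F) x); first by right.
    by left; exists x => //; rewrite gN.
  + apply: (@ideal_subset _ I (g @` E) (E `|` S)); last exact: ideal_setU.
    move=> _ [x Ex <-]; have [x1|x1] := pselect ((S `|` F) x).
      by right; rewrite gSF.
    by left; rewrite gN.
Qed.

Lemma image_setI_preimage (T U V : Type) (f : T -> U) (p : U -> V) (E : set T)
  (B : set V) : f @` (E `&` (p \o f) @^-1` B) = f @` E `&` p @^-1` B.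
Proof.
apply/seteqP; split=> [_ [x [Ex Bx] <-]|_ [[x Ex <-] Bx]].
  by split=> //; exists x.
by exists x.
Qed.

Lemma sum_along_pull (X Y : countType) (I : ideal Y) (f : X -> Y) (p : Y -> nat) :
  (forall E, E `<=` range f -> I E <-> forall n, I (E `&` p @^-1` [set n])) ->
  sum_along (pull_ideal f I) (p \o f).
Proof.
move=> Ip E; rewrite /= Ip; last by move=> _ [x _ <-]; exists x.
by split=> + n => /(_ n); rewrite image_setI_preimage.
Qed.

Lemma bounded_sum_along_pull (X Y : countType) (I : ideal Y) (f : X -> Y)
    (p : Y -> nat) :
  (forall E, E `<=` range f ->
    I E <-> (forall n, I (E `&` p @^-1` [set n])) /\ bounded_on p E) ->
  bounded_sum_along (pull_ideal f I) (p \o f).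
Proof.
move=> Ip E; rewrite /= Ip; last by move=> _ [x _ <-]; exists x.
split=> -[Ep [N EN]]; split.
- by move=> n; rewrite image_setI_preimage.
- by exists N => x Ex; apply: EN; exists x.
- by move=> n; rewrite -image_setI_preimage.
- by exists N => _ [x Ex <-]; exact: EN.
Qed.

(** A finite fibre cannot be a summand. If the union [F] of these fibres is finite, the remaining
    ones absorb it; if it is infinite, it becomes one new summand, a full power set. *)
Lemma calB_sum_along (J : ideal nat) (q : nat -> nat) : sum_along J q ->
  (forall n, infinite_set (q @^-1` [set n]) -> in_calB J (q @^-1` [set n])) ->
  calB J.
Proof.
move=> Jq Bq; pose F := [set m | finite_set (q @^-1` [set q m])].
have [Ffin|Finf] := pselect (finite_set F).
  have [g [gI gF <-]] := absorb_finite J Ffin.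
  have gfib n : g @` ((q \o g) @^-1` [set n]) = q @^-1` [set n] `&` ~` F.
    by rewrite -gF setIC -image_setI_preimage setTI.
  apply: (@calB_sum_along_nonempty _ (q \o g)).
    by apply: sum_along_pull => E _; exact: Jq.
  move=> n [x /= qgx]; apply: in_calB_pull => //; rewrite gfib.
  have ninf : infinite_set (q @^-1` [set n]).
    have : (~` F) (g x) by rewrite -gF; exists x.
    by rewrite /F /= qgx.
  rewrite (_ : _ `&` _ = q @^-1` [set n]); first exact: Bq.
  by apply/seteqP; split=> [y []//|y /= qy]; split=> //; rewrite /F /= qy.
(* [r] gathers the finite fibres of [q] over 0 and shifts the infinite ones by one. *)
pose r m := if m \in F then 0%N else (q m).+1.
have rF m : F m -> r m = 0%N by move=> Fm; rewrite /r mem_set.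
have rN m : ~ F m -> r m = (q m).+1 by move=> Fm; rewrite /r memNset.
apply: (@calB_sum_along_nonempty _ r).
  move=> E; split=> [JE n|JE]; first by apply: ideal_subset JE; exact: subIsetl.
  apply/Jq => n.
  have [nf|ni] := pselect (finite_set (q @^-1` [set n])).
    by apply: ideal_finite; apply: sub_finite_set nf; exact: subIsetr.
  apply: ideal_subset (JE n.+1) => x [Ex /= qx]; split=> //=.
  by rewrite rN ?qx// /F /= qx.
move=> [|n] [x /=].
  move=> _; have -> : r @^-1` [set 0%N] = F.
    apply/seteqP; split=> y /=; last exact: rF.
    by move=> ry; apply: contrapT => /rN; rewrite ry.
  apply: in_calB_all => //; apply/Jq => n; apply: ideal_finite.
  have [nf|ni] := pselect (finite_set (q @^-1` [set n])).
    by apply: sub_finite_set nf; exact: subIsetr.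
  rewrite (_ : _ `&` _ = set0) //; apply/seteqP; split=> // y [].
  by rewrite /F /= => + qy; rewrite qy.
have [/rF->//|nFx] := pselect (F x); rewrite rN// => -[qx].
have -> : r @^-1` [set n.+1] = q @^-1` [set n].
  apply/seteqP; split=> y /=.
    by have [/rF->//|/rN->] := pselect (F y); case.
  by move=> qy; rewrite rN ?qy// /F /= qy -qx.
by apply: Bq; rewrite -qx.
Qed.

Lemma in_calB_sum (X : countType) (I : ideal X) (K : set X) (p : X -> nat) :
  infinite_set K ->
  (forall E, E `<=` K -> I E <-> forall n, I (E `&` p @^-1` [set n])) ->
  (forall n, infinite_set (K `&` p @^-1` [set n]) ->
    in_calB I (K `&` p @^-1` [set n])) ->
  in_calB I K.
Proof.
move=> /infinite_enum[f fI fK] Ip Bp; exists f; split=> //.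
apply: (@calB_sum_along _ (p \o f)).
  by apply: sum_along_pull; rewrite fK.
have fib n : f @` ((p \o f) @^-1` [set n]) = K `&` p @^-1` [set n].
  by rewrite -[X in f @` X]setTI image_setI_preimage fK.
move=> n /(infinite_image fI); rewrite fib => /Bp Bn.
by apply: in_calB_pull; rewrite ?fib.
Qed.

(** Trades the partition and its subtypes for a map [q] whose fibres are the pieces, each enumerated
    by some [f n]. *)
Lemma direct_sumP (D : set nat) (I : nat -> ideal nat) (J : ideal nat) :
  direct_sum D I J -> exists (q : nat -> nat) (f : nat -> nat -> nat),
    [/\ sum_along J q, forall m, D (q m) &
      forall n, D n -> [/\ injective (f n), range (f n) = q @^-1` [set n] &
        pull_ideal (f n) J = I n]].
Proof.
move=> [K [I' [[DK Ktriv _] iso JE]]].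
have /choice[q qP] : forall m, exists n, D n /\ K n m.
  by move=> m; have : [set: nat] m by []; rewrite -DK => -[n Dn Kn]; exists n.
have Kq m n : D n -> K n m -> n = q m.
  move=> Dn Kn; apply: Ktriv => //; first exact: (qP m).1.
  by exists m; split=> //; exact: (qP m).2.
have qK n : D n -> q @^-1` [set n] = K n.
  move=> Dn; apply/seteqP; split=> m /=; first by move=> <-; exact: (qP m).2.
  by move=> /(Kq _ _ Dn).
have /choice[f fP] : forall n, exists f : nat -> nat, D n ->
    [/\ injective f, range f = K n &
      forall E, I n E <-> I' n (val @^-1` (f @` E))].
  move=> n; have [Dn|] := pselect (D n); last by exists id.
  have [h [g hK gK] hI] := iso n Dn; exists (val \o h) => _; split.
  - by move=> x y /= /val_inj /(can_inj hK).
  - apply/seteqP; split=> [_ [x _ <-]|x Kx].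
      by have := valP (h x); rewrite inE.
    by exists (g (exist _ x (mem_set Kx))) => //=; rewrite gK.
  - move=> E; rewrite hI (_ : h @` E = val @^-1` ((val \o h) @` E)) //.
    apply/seteqP; split=> [_ [x Ex <-]|y [x Ex] /val_inj <-]; by exists x.
exists q, f; split.
- move=> E; split=> [JEE n|EJ]; first by apply: ideal_subset JEE; exact: subIsetl.
  apply/JE => n Dn; have /JE/(_ n Dn) := EJ n.
  apply: ideal_subset => x Ex; split=> //; rewrite qK//.
  by have := valP x; rewrite inE.
- by move=> m; exact: (qP m).1.
- move=> n Dn; have [fI fK fII] := fP n Dn; split=> //; first by rewrite qK.
  apply: ideal_ext => E; rewrite fII /= JE; split=> [/(_ n Dn)//|IE m Dm].
  have [->//|/eqP mn] := eqVneq m n.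
  apply: ideal_finite; rewrite (_ : _ @^-1` _ = set0) //.
  apply/seteqP; split=> // x [y Ey fyx]; apply: mn.
  have Kx : K m (val x) by have := valP x; rewrite inE.
  rewrite (Kq _ _ Dm Kx); symmetry; apply: Kq => //.
  by rewrite -fyx -fK; exists y.
Qed.

(** For finite sets, test against the whole of [nat]. For a sum, work on each fibre, where pulling
    back commutes with both orthogonals. An orthogonal always equals its own double orthogonal. *)
Lemma calB_orthK (J : ideal nat) : calB J -> orth_ideal (orth_ideal J) = J.
Proof.
move=> BJ; apply: ideal_ext => E; split; last exact: orthK_sub.
elim: BJ E => {J} [|D I J _ IH /direct_sumP[q [f [Jq qD fP]]]|J _ _] E.
- by move=> /(_ setT); rewrite setTI; apply=> A fA; exact: finite_setIl.
- move=> oE; apply/Jq => n.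
  have [Dn|nD] := pselect (D n); last first.
    apply: ideal_finite; rewrite (_ : _ `&` _ = set0) //.
    by apply/seteqP; split=> // x [_ /= qx]; apply: nD; rewrite -qx.
  have [fI <- fJ] := fP n Dn.
  apply/pull_preimage; rewrite fJ; apply: IH => //.
  rewrite -fJ -!pull_orth//; apply/pull_preimage.
  by apply: ideal_subset oE; exact: subIsetl.
- by move=> oE A JA; apply: oE; exact: orthK_sub.
Qed.

(** The orthogonal of a bounded sum is a direct sum, so the bounded sum is reached as the orthogonal
    of that, once it is known to be its own double orthogonal. *)
Lemma in_calB_bounded_sum (X : countType) (I : ideal X) (K : set X) (p : X -> nat) :
  infinite_set K ->
  (forall E, E `<=` K ->
    I E <-> (forall n, I (E `&` p @^-1` [set n])) /\ bounded_on p E) ->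
  (forall n, infinite_set (K `&` p @^-1` [set n]) ->
    in_calB I (K `&` p @^-1` [set n])) ->
  in_calB I K.
Proof.
move=> /infinite_enum[f fI fK] Ip Bp; exists f; split=> //.
have fib n : f @` ((p \o f) @^-1` [set n]) = K `&` p @^-1` [set n].
  by rewrite -[X in f @` X]setTI image_setI_preimage fK.
set J := pull_ideal f I; set q := p \o f.
have Jq : bounded_sum_along J q by apply: bounded_sum_along_pull; rewrite fK.
have Bq n : infinite_set (q @^-1` [set n]) -> in_calB J (q @^-1` [set n]).
  move=> /(infinite_image fI); rewrite fib => /Bp Bn.
  by apply: in_calB_pull; rewrite ?fib.
suff <- : orth_ideal (orth_ideal J) = J.
  apply/calB_orth/(@calB_sum_along _ q) => [|n /Bq]; last exact: in_calB_orth.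
  exact: orth_bounded_sum.
apply: ideal_ext => E; split; last exact: orthK_sub.
move=> /(orth_sum (orth_bounded_sum Jq))[oE Eb]; apply/Jq; split=> // n.
have [nf|ni] := pselect (finite_set (q @^-1` [set n])).
  by apply: ideal_finite; apply: sub_finite_set nf; exact: subIsetr.
have [e [eI eq Be]] := Bq n ni.
rewrite -eq; apply/pull_preimage; rewrite -(calB_orthK Be) -!(pull_orth _ eI).
by apply/pull_preimage; rewrite eq; exact: oE.
Qed.

(** * Borel sets *)

Section BorelSets.
Variable X : countType.
Implicit Types U : set {ptws X -> bool}.

Definition borel_set U := <<s [set U : set {ptws X -> bool} | open U] >> U.

(** Agreement with [x] on finite sets [s] gives the basic neighbourhoods of [x]; with values in
    [nat] the same notion serves Baire space. *)
Definition agree (T : Type) (s : seq X) (x y : X -> T) := forall a, a \in s -> x a = y a.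

Lemma agree_filter (x : X -> bool) :
  Filter [set U | exists s, [set y | agree s x y] `<=` U].
Proof.
split.
- by exists [::].
- move=> U V [s sU] [t tV]; exists (s ++ t) => y xy; split.
    by apply: sU => a ast; apply: xy; rewrite mem_cat ast.
  by apply: tV => a ast; apply: xy; rewrite mem_cat ast orbT.
- by move=> U V UV [s sU]; exists s; exact: subset_trans UV.
Qed.

(** The filter generated by these sets converges to [x] in each coordinate, hence in the product
    topology. *)
Lemma open_agree U (x : X -> bool) : open U -> U x ->
  exists s, [set y | agree s x y] `<=` U.
Proof.
move=> oU Ux; have FF := agree_filter x.
suff : {ptws, [set U | exists s, [set y | agree s x y] `<=` U] --> x}.
  by apply; exact: open_nbhs_nbhs.
apply/cvg_sup => a /= V.
rewrite (@nbhsE (initial_topology (fun f : X -> bool => f a))).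
move=> [_ [[W oW <-] /= Wx] WV]; exists [:: a] => y xy; apply: WV => /=.
by rewrite -xy// mem_head.
Qed.

Lemma open_coord a (b : bool) : open ([set x : {ptws X -> bool} | x a = b]).
Proof.
rewrite openE => x /= xa; rewrite /interior.
apply: (@proj_continuous X (fun=> bool) a x [set b]).
by apply: open_nbhs_nbhs; split; first exact: discrete_open.
Qed.

Lemma borel_open U : open U -> borel_set U.
Proof. exact: sub_sigma_algebra. Qed.

Lemma borel_setC U : borel_set U -> borel_set (~` U).
Proof. by move=> bU; rewrite -setTD; exact: sigma_algebraCD. Qed.

Lemma borel_exists (F : nat -> set {ptws X -> bool}) :
  (forall n, borel_set (F n)) -> borel_set [set x | exists n, F n x].
Proof.
move=> bF; rewrite (_ : [set x | _] = \bigcup_n F n).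
  by apply: (@sigma_algebra_bigcup _ setT [set U | open U]) => n; exact: bF.
by apply/seteqP; split=> x [n]; exists n.
Qed.

Lemma borel_forall (F : nat -> set {ptws X -> bool}) :
  (forall n, borel_set (F n)) -> borel_set [set x | forall n, F n x].
Proof.
move=> bF; rewrite (_ : [set x | _] = ~` [set x | exists n, (~` F n) x]).
  by apply: borel_setC; apply: borel_exists => n; apply: borel_setC; exact: bF.
apply/seteqP; split=> x /=; first by move=> Fx [n]; apply.
by move=> nFx n; apply: contrapT => Fnx; apply: nFx; exists n.
Qed.

Lemma borel_imply (P : Prop) U : (P -> borel_set U) -> borel_set [set x | P -> U x].
Proof.
have [p bU|np _] := pselect P.
  by rewrite (_ : [set x | _] = U); [exact: bU|apply/seteqP; split=> x /=; tauto].
rewrite (_ : [set x | _] = setT); first exact: borel_open openT.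
by apply/seteqP; split=> x //= _ /np.
Qed.

Lemma borel_setI U V : borel_set U -> borel_set V -> borel_set (U `&` V).
Proof.
move=> bU bV; rewrite (_ : _ `&` _ = [set x | forall n, (if n is 0 then U else V) x]).
  by apply: borel_forall => -[].
apply/seteqP; split=> x /=; first by case=> ? ? [].
by move=> UV; split; [exact: (UV 0%N)|exact: (UV 1%N)].
Qed.

(** Coordinate sets suffice as generators: there are countably many cylinders [N s], and an open set
    is the union of those it contains. *)
Lemma borel_ind (P : set {ptws X -> bool} -> Prop) :
  P set0 -> (forall a, P [set x : {ptws X -> bool} | x a]) ->
  (forall U, P U -> P (~` U)) ->
  (forall F : nat -> set {ptws X -> bool},
    (forall n, P (F n)) -> P [set x | exists n, F n x]) ->
  forall U, borel_set U -> P U.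
Proof.
move=> P0 Pa PC PE; apply: smallest_sub.
  split=> // [U PU|F PF]; first by rewrite setTD; exact: PC.
  rewrite (_ : \bigcup_n _ = [set x | exists n, F n x]); first exact: PE.
  by apply/seteqP; split=> x [n]; exists n.
have PI U V : P U -> P V -> P (U `&` V).
  move=> PU PV.
  rewrite (_ : _ `&` _ =
    ~` [set x | exists n, (if n is 0 then ~` U else ~` V) x]).
    by apply/PC/PE => -[|n]; exact: PC.
  apply/seteqP; split=> x /=; first by case=> Ux Vx [[|n]].
  move=> nUV; split; apply: contrapT => nx; apply: nUV.
    by exists 0%N.
  by exists 1%N.
pose N (s : seq (X * bool)) := [set x : {ptws X -> bool} | all (fun p => x p.1 == p.2) s].
have PN s : P (N s).
  elim: s => [|[a b] s IH].
    by rewrite (_ : N _ = ~` set0); [exact: PC|rewrite setC0; apply/seteqP; split].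
  pose V := [set x : {ptws X -> bool} | x a].
  rewrite (_ : N _ = (if b then V else ~` V) `&` N s).
    by apply: PI => //; case: b; [exact: Pa|apply: PC; exact: Pa].
  apply/seteqP; split=> x; rewrite /N /V /=.
    by move=> /andP[/eqP xa xs]; split=> //; case: b xa => /= ->.
  by case=> + ->; case: b => /= xa; rewrite andbT; apply/eqP => //; apply/negbTE/negP.
move=> U /= oU.
pose F n : set {ptws X -> bool} :=
  if unpickle n is Some s then [set x | N s `<=` U /\ N s x] else set0.
rewrite (_ : U = [set x | exists n, F n x]).
  apply: PE => n; rewrite /F; case: (unpickle n) => [s|]; last exact: P0.
  have [NU|NU] := pselect (N s `<=` U).
    by rewrite (_ : [set x | _] = N s) //; apply/seteqP; split=> x //= -[].
  by rewrite (_ : [set x | _] = set0) //; apply/seteqP; split=> x //= -[].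
apply/seteqP; split=> x /=; last first.
  by case=> n; rewrite /F; case: (unpickle n) => // s [NU /NU].
move=> Ux; have [s sU] := open_agree oU Ux.
exists (pickle [seq (a, x a) | a <- s]); rewrite /F pickleK; split.
  move=> y /allP /= xy; apply: sU => a sa /=.
  by have /eqP := xy _ (map_f (fun a => (a, x a)) sa).
by apply/allP => _ /mapP[a _ ->] /=.
Qed.

End BorelSets.

Lemma borel_preimage (X Y : countType) (phi : (X -> bool) -> (Y -> bool))
    (U : set {ptws Y -> bool}) :
  (forall a, borel_set [set x : {ptws X -> bool} | phi x a]) ->
  borel_set U -> borel_set (phi @^-1` U : set {ptws X -> bool}).
Proof.
move=> bphi; move: U; apply: borel_ind => //.
- by rewrite preimage_set0; exact: borel_open open0.
- by move=> U; exact: borel_setC.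
- by move=> F bF; exact: (borel_exists bF).
Qed.

Lemma borel_embeds (X Y : countType) (I : ideal X) (J : ideal Y) :
  embeds I J -> borel J -> borel I.
Proof.
move=> [f fI IJ] bJ.
(* [phi x] is the characteristic function of the image under [f]; each of its coordinates is a
   coordinate of [x] or constantly false. *)
pose phi (x : X -> bool) (b : Y) : bool := `[< exists2 a, f a = b & x a >].
rewrite /borel (_ : [set chi : {ptws X -> bool} | _] =
    phi @^-1` [set chi | J [set y | chi y]]).
  apply: (borel_preimage _ bJ) => b.
  have [[a <-]|nb] := pselect (exists a, f a = b).
    rewrite (_ : [set x | _] = [set x | x a = true]).
      exact: borel_open (open_coord _ _).
    apply/seteqP; split=> x /=; first by move=> /asboolP[c /fI ->].
    by move=> xa; apply/asboolP; exists a.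
  rewrite (_ : [set x | _] = set0); first exact: borel_open open0.
  by apply/seteqP; split=> x //= /asboolP[a fa _]; apply: nb; exists a.
apply/seteqP; split=> x /=; rewrite IJ (_ : f @` _ = [set y | phi x y]) //;
  by apply/seteqP; split=> y /=; [move=> [a xa <-]; apply/asboolP; exists a|
    move=> /asboolP[a fa xa]; exists a].
Qed.

Lemma borel_pull (J : ideal nat) (f : nat -> nat) : borel J ->
  borel_set [set x : {ptws nat -> bool} | J (f @^-1` [set m | x m])].
Proof.
move=> bJ.
apply: (@borel_preimage _ _ (fun x n => x (f n)) [set x | J [set m | x m]]) => // a.
exact: borel_open (open_coord (f a) true).
Qed.

Lemma borel_fin : borel (fin_ideal nat).
Proof.
rewrite /borel (_ : [set x : {ptws nat -> bool} | _] =
  [set x | exists N : nat, forall n : nat,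
    [set x : {ptws nat -> bool} | (N <= n)%N -> x n = false] x]).
  apply: borel_exists => N; apply: borel_forall => n.
  apply: borel_imply => _; exact: borel_open (open_coord _ _).
apply/seteqP; split=> x /=.
  move=> /finite_seqP[s xs]; exists (\max_(i <- s) i).+1 => n.
  apply: contraTF => xn; rewrite -leqNgt; apply: leq_bigmax_seq => //.
  by have : [set n | x n] n by []; rewrite xs.
move=> [N xN]; apply: sub_finite_set (finite_II N) => n /= xn.
by rewrite ltnNge; apply/negP => /xN; rewrite xn.
Qed.

(** Carrying both claims through the induction settles orthogonals, as [J] is its own double
    orthogonal. For a sum, both ideals are given by conditions on the fibres, plus a bound on [q] in
    the case of the orthogonal. *)
Lemma calB_borel_orth (J : ideal nat) : calB J -> borel J /\ borel (orth_ideal J).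
Proof.
elim=> {J} [|D I J BI IH /direct_sumP[q [f [Jq qD fP]]]|J BJ [bJ boJ]]; last first.
- by rewrite calB_orthK.
- have fib (I' : ideal nat) n : D n -> forall x : nat -> bool,
      I' ([set m | x m] `&` q @^-1` [set n]) <->
      pull_ideal (f n) I' (f n @^-1` [set m | x m]).
    by move=> /fP[_ <- _] x; rewrite pull_preimage.
  have nD (I' : ideal nat) n : ~ D n -> forall E, I' (E `&` q @^-1` [set n]).
    move=> nDn E; apply: ideal_finite; rewrite (_ : _ `&` _ = set0) //.
    by apply/seteqP; split=> // m [_ /= qm]; apply: nDn; rewrite -qm.
  have bsum (I' : ideal nat) : (forall n, D n -> borel (pull_ideal (f n) I')) ->
      borel_set [set x : {ptws nat -> bool} |
        forall n, I' ([set m | x m] `&` q @^-1` [set n])].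
    move=> bI'; apply: borel_forall => n.
    have [Dn|/nD nDn] := pselect (D n).
      rewrite [X in borel_set X](_ : _ = [set x : {ptws nat -> bool} |
          pull_ideal (f n) I' (f n @^-1` [set m | x m])]).
        apply: borel_pull; exact: bI'.
      by apply/seteqP; split=> x /= /(fib _ _ Dn).
    rewrite [X in borel_set X](_ : _ = setT); first exact: borel_open openT.
    by apply/seteqP; split=> x //= _; exact: nDn.
  split.
    rewrite /borel (_ : [set x | _] = [set x : {ptws nat -> bool} |
        forall n, J ([set m | x m] `&` q @^-1` [set n])]).
      by apply: bsum => n Dn; have [_ _ ->] := fP n Dn; exact: (IH n Dn).1.
    by apply/seteqP; split=> x /= /Jq.
  rewrite /borel (_ : [set x | _] = [set x : {ptws nat -> bool} |
      forall n, orth_ideal J ([set m | x m] `&` q @^-1` [set n])] `&`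
      [set x | exists N : nat, forall m : nat,
        [set x : {ptws nat -> bool} | ~ (q m <= N)%N -> x m = false] x]).
    apply: borel_setI.
      apply: bsum => n Dn; have [fI _ fJ] := fP n Dn.
      by rewrite pull_orth// fJ; exact: (IH n Dn).2.
    apply: borel_exists => N; apply: borel_forall => m.
    apply: borel_imply => _; exact: borel_open (open_coord _ _).
  apply/seteqP; split=> x.
    move=> /(orth_sum Jq)[oJ [N xN]]; split=> //; exists N => m /= qm.
    by apply/negP => /xN.
  move=> [oJ [N xN]]; apply/(orth_sum Jq); split=> //; exists N => m /= xm.
  by apply: contrapT => /xN; rewrite xm.
- split; first exact: borel_fin.
  rewrite /borel -/(borel_set _) [X in borel_set X](_ : _ = setT).
    exact: borel_open openT.
  by apply/seteqP; split=> x //= _ A fA; exact: finite_setIl.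
Qed.

(** * WO is not analytic *)

Section Analytic.
Variable X : countType.

(** Closedness in the product of Cantor and Baire space, in terms of finite approximations; analytic
    sets are the projections of closed ones. *)
Definition closed_rel (C : (X -> bool) -> (nat -> nat) -> Prop) := forall x z,
  (forall (s : seq X) (t : seq nat),
    exists x' z', [/\ C x' z', agree s x x' & agree t z z']) -> C x z.

Definition analytic (U : set {ptws X -> bool}) :=
  exists2 C, closed_rel C & forall x, U x <-> exists z, C x z.

Lemma analytic_cst (P : Prop) : analytic [set _ | P].
Proof.
exists (fun _ _ => P).
  by move=> x z /(_ [::] [::])[? [? []]].
by move=> x; split=> [p|[]//]; exists id.
Qed.

Lemma analytic_coord a b : analytic [set x : {ptws X -> bool} | x a = b].
Proof.
exists (fun x _ => x a = b).
  by move=> x z /(_ [:: a] [::])[x' [z' [<- ->//]]]; rewrite mem_head.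
by move=> x; split=> [p|[]//]; exists id.
Qed.

Lemma analytic_exists (F : nat -> set {ptws X -> bool}) :
  (forall n, analytic (F n)) -> analytic [set x | exists n, F n x].
Proof.
move=> /(_ _)/cid2-/all_sig2[C cC CF].
(* The first value of [z] names the set, and its tail is the witness. *)
exists (fun x z => C (z 0%N) x (z \o S)) => [x z Cxz|x].
  apply: cC => s t; have [x' [z' [Cxz' sx tz]]] := Cxz s (0%N :: map S t).
  exists x', (z' \o S); split=> //; first by rewrite tz ?mem_head.
  by move=> i it /=; rewrite tz// in_cons map_f ?orbT.
split=> [[n /CF[z Cxz]]|[z Cxz]]; last by exists (z 0%N); apply/CF; exists (z \o S).
by exists (fun i => if i is j.+1 then z j else n).
Qed.

Lemma analytic_forall (F : nat -> set {ptws X -> bool}) :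
  (forall n, analytic (F n)) -> analytic [set x | forall n, F n x].
Proof.
move=> /(_ _)/cid2-/all_sig2[C cC CF].
(* A single [z] codes a witness for every [n], read off through a pairing. *)
exists (fun x z => forall n, C n x (fun i => z (pickle (n, i)))) => [x z Cxz n|x].
  apply: cC => s t.
  have [x' [z' [Cxz' sx tz]]] := Cxz s [seq pickle (n, i) | i <- t].
  exists x', (fun i => z' (pickle (n, i))); split=> // i it.
  by apply: tz; exact: (map_f (fun i => pickle (n, i))).
split=> [Fx|[z Cxz] n]; last by apply/CF; eexists; exact: Cxz.
have /choice[z Cz] : forall n, exists z, C n x z by move=> n; exact/CF.
exists (fun m => if unpickle m is Some (n, i) then z n i else 0%N) => n.
suff -> : (fun i => if unpickle (pickle (n, i)) is Some (n', i') then z n' i' else 0%N)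
  = z n by [].
by apply/funext => i; rewrite pickleK.
Qed.

(** Analyticity does not pass to complements, so the induction carries the complement along. *)
Lemma borel_analytic (U : set {ptws X -> bool}) : borel_set U -> analytic U.
Proof.
suff : borel_set U -> analytic U /\ analytic (~` U) by tauto.
move: U; apply: borel_ind.
- split; first by have := analytic_cst False; congr analytic; apply/seteqP; split.
  by have := analytic_cst True; congr analytic; apply/seteqP; split => // x _ [].
- move=> a; split; first exact: analytic_coord.
  have := analytic_coord a false; congr analytic; apply/seteqP; split => x /=.
    by move=> ->.
  by move=> /negP/negbTE.
- by move=> U [aU aNU]; rewrite setCK.
- move=> F aF; split; first by apply: analytic_exists => n; have [] := aF n.
  rewrite (_ : ~` _ = [set x | forall n, (~` F n) x]).
    by apply: analytic_forall => n; have [] := aF n.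
  by apply/seteqP; split=> x /=; [move=> nF n Fn; apply: nF; exists n|
    move=> nF [n Fn]; apply: nF Fn].
Qed.

End Analytic.

(** * Kleene-Brouwer orders, branches and well-foundedness *)

Section KleeneBrouwer.
Local Open Scope ring_scope.

(* An embedding of the Kleene-Brouwer order on finite sequences into (0, 1]. *)
Fixpoint kb (s : seq nat) : rat :=
  if s is n :: s' then 1 - (1 + n%:R + kb s')^-1 else 1.

Lemma kb_itv s : 0 < kb s <= 1.
Proof.
elim: s => [//|n s /andP[s0 s1]] /=.
have n0 : 0 <= n%:R :> rat by [].
have p : 0 < 1 + n%:R + kb s by lra.
rewrite lerBlDr lerDl invr_ge0 (ltW p) andbT subr_gt0 invf_lt1//; lra.
Qed.

Lemma kb_cons_lt1 n s : kb (n :: s) < kb [::].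
Proof.
have /andP[s0 _] := kb_itv s; have n0 : 0 <= n%:R :> rat by [].
by rewrite /= ltrBlDr ltrDl invr_gt0; lra.
Qed.

Lemma kb_cons_lt n s t : kb s < kb t -> kb (n :: s) < kb (n :: t).
Proof.
have /andP[s0 _] := kb_itv s; have /andP[t0 _] := kb_itv t.
have n0 : 0 <= n%:R :> rat by [].
by move=> st /=; rewrite ltrD2l ltrN2 ltf_pV2 ?ltrD2l// posrE; lra.
Qed.

(** Sequences with head [n] land in the interval from n/(n+1), excluded, to (n+1)/(n+2), and these
    intervals move up with [n]. *)
Lemma kb_head_lt m n s t : (m < n)%N -> kb (m :: s) < kb (n :: t).
Proof.
have /andP[s0 s1] := kb_itv s; have /andP[t0 _] := kb_itv t.
have n0 : 0 <= m%:R :> rat by [].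
rewrite -(ler_nat rat) -natr1 => mn /=.
by rewrite ltrD2l ltrN2 ltf_pV2 ?posrE; lra.
Qed.

Lemma kb_cat_lt u s t : kb s < kb t -> kb (u ++ s) < kb (u ++ t).
Proof. by move=> st; elim: u => //= n u; exact: kb_cons_lt. Qed.

Lemma kb_inj : injective kb.
Proof.
elim=> [|m s IH] [|n t] // st.
- by have := kb_cons_lt1 n t; rewrite -st ltxx.
- by have := kb_cons_lt1 m s; rewrite st ltxx.
- have [mn|nm|mn] := ltngtP m n.
  + by have := kb_head_lt s t mn; rewrite st ltxx.
  + by have := kb_head_lt t s nm; rewrite st ltxx.
  + move: st; rewrite mn /= => /addrI/oppr_inj/invr_inj/addrI/IH ->//.
Qed.

End KleeneBrouwer.

Lemma prefix_closed (S : seq nat -> Prop) : (forall s n, S (rcons s n) -> S s) ->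
  forall s u, S (s ++ u) -> S s.
Proof.
move=> Sp s; elim/last_ind => [|u n IH]; first by rewrite cats0.
by rewrite -rcons_cat => /Sp.
Qed.

(** An extension comes before the sequence it extends, so the initial segments of [z] descend
    forever. *)
Lemma kb_branch_not_wo (S : seq nat -> Prop) z :
  (forall n, S (mkseq z n)) -> ~ well_ordered (kb @` S).
Proof.
move=> Sz /(_ (range (fun n => kb (mkseq z n)))).
case=> [_ [n _ <-]||_ [n _ <-]].
- by exists (mkseq z n).
- by exists (kb (mkseq z 0)), 0%N.
- move=> /(_ (kb (mkseq z n.+1))) /=.
  have lt : (kb (mkseq z n.+1) < kb (mkseq z n))%O.
    rewrite mkseqS -cats1 -[X in (_ < kb X)%O]cats0.
    exact/kb_cat_lt/kb_cons_lt1.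
  by rewrite leNgt lt => H; have : false by apply: H; exists n.+1.
Qed.

(** If the subtree at a node is not well ordered, neither is the subtree at some child; following
    such children gives a branch. *)
Lemma kb_not_wo_branch (S : seq nat -> Prop) :
  (forall s n, S (rcons s n) -> S s) -> ~ well_ordered (kb @` S) ->
  exists z, forall n, S (mkseq z n).
Proof.
move=> Sp nwS.
pose sub s := [set kb (s ++ u) | u in [set u | S (s ++ u)]].
have subS s : ~ well_ordered (sub s) -> S s.
  move=> nw; apply: contrapT => nS; apply: nw => B Bs [b Bb].
  by have [u /(prefix_closed Sp)] := Bs _ Bb.
have step s : exists n, ~ well_ordered (sub s) -> ~ well_ordered (sub (rcons s n)).
  apply: contrapT => nex.
  have nw : ~ well_ordered (sub s).
    by move=> ws; apply: nex; exists 0%N.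
  have wos n : well_ordered (sub (rcons s n)).
    by apply: contrapT => nwn; apply: nex; exists n.
  apply: nw => B Bs [b Bb].
  (* If the subtrees at all children are well ordered, the least element of [B] lies at the first
     child that [B] meets, or is the image of [s] when [B] meets none. *)
  pose P n := `[< exists u, B (kb (s ++ n :: u)) >].
  have [exP|nP] := pselect (exists n, P n); last first.
    have Bkb c : B c -> c = kb s.
      move=> Bc; have [[|n u] _ cE] := Bs _ Bc; first by rewrite -cE cats0.
      by case: nP; exists n; apply/asboolP; exists u; rewrite cE.
    by exists b => // c Bc; rewrite (Bkb _ Bb) (Bkb _ Bc).
  case: (ex_minnP exP) => n /asboolP[u Bu] nmin.
  have [||m [Bm [v _ vm]] mB] := wos n (B `&` sub (rcons s n)).
  - exact: subIsetr.
  - exists (kb (s ++ n :: u)); split=> //; exists u; rewrite /= cat_rcons //.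
    have [w Sw /kb_inj wE] := Bs _ Bu.
    by rewrite -wE.
  - exists m => // c Bc; have [[|k w] Sw cE] := Bs _ Bc.
      rewrite -cE -vm cat_rcons; apply/ltW/kb_cat_lt; exact: kb_cons_lt1.
    have : (n <= k)%N by apply: nmin; apply/asboolP; exists w; rewrite cE.
    rewrite leq_eqVlt => /orP[/eqP nk|nk].
      by apply: mB; split=> //; exists w; rewrite /= cat_rcons nk.
    by rewrite -cE -vm cat_rcons; apply/ltW/kb_cat_lt; exact: kb_head_lt.
have [next nextP] := choice step.
pose b := fix b k := if k is k'.+1 then rcons (b k') (next (b k')) else [::].
exists (fun k => next (b k)) => n; have -> : mkseq (fun k => next (b k)) n = b n.
  by elim: n => // n IH; rewrite mkseqS IH.
apply: subS; elim: n => [|n IH] /=; last exact: nextP.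
by [].
Qed.

(* Diagonalization: given an analytic code C for WO, the tree of attempts to
   build a branch witnessing that x is in WO depends, at a node s, only on the
   values of x at level below the length of s, so that there is a set x which
   equals the Kleene-Brouwer image of its own tree; but this image is well
   ordered iff the tree has no branch iff x is not in WO. *)
Lemma not_analytic_WO : ~ analytic [set x : {ptws rat -> bool} | WO [set r | x r]].
Proof.
move=> [C cC CW].
(* [lvl r] is the length of the sequence coded by [r], and 0 if [r] codes none. *)
pose lvl r := size (xget [::] [set s | kb s = r]).
have lvl_kb s : lvl (kb s) = size s.
  rewrite /lvl; case: xgetP => [t _ /= /kb_inj ->//|] /(_ s) /=.
  by case.
(* [s] is a node if some pair in [C] has second part starting with [s] and first part agreeing with
   [x] on the levels below the length of [s]. *)
pose T (x : rat -> bool) s := exists x' z, [/\ C x' z,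
  forall r, (lvl r < size s)%N -> x r = x' r & mkseq z (size s) = s].
have T_ext x y s : (forall r, (lvl r < size s)%N -> x r = y r) -> T x s -> T y s.
  by move=> xy [x' [z [Cxz xx' zs]]]; exists x', z; split=> // r rs; rewrite -xy// xx'.
(* Starting from the empty set, iterate the map from a set to the image of its tree; the value at
   [r] is settled after [lvl r + 1] rounds. *)
pose it := fix it k : rat -> bool :=
  if k is k'.+1 then fun r => `[< exists2 s, kb s = r & T (it k') s >] else xpred0.
have itS k r : (lvl r < k)%N -> it k.+1 r = it k r.
  elim: k r => // k IH r; rewrite ltnS => rk.
  have H s : kb s = r -> forall r', (lvl r' < size s)%N -> it k.+1 r' = it k r'.
    move=> sr r' r's; apply: IH; apply: leq_trans r's _.
    by rewrite -lvl_kb sr.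
  apply: asbool_equiv_eq; split=> -[s sr Ts]; exists s => //; apply: T_ext Ts.
    exact: H.
  by move=> r' /(H _ sr).
have itD k j r : (lvl r < k)%N -> it (j + k)%N r = it k r.
  move=> rk; elim: j => // j IH; rewrite addSn itS//.
  by apply: leq_trans rk _; exact: leq_addl.
pose x r := it (lvl r).+1 r.
have xit k r : (lvl r < k)%N -> x r = it k r.
  by move=> rk; rewrite -(subnK rk) itD.
have xT : [set r | x r] = kb @` T x.
  apply/seteqP; split=> [r /asboolP[s sr Ts]|_ [s Ts <-]].
    exists s => //; apply: T_ext Ts => r' r's.
    by rewrite (xit (lvl r))// -sr lvl_kb.
  apply/asboolP; exists s => //; apply: T_ext Ts => r' r's.
  by rewrite (xit (lvl (kb s)))// lvl_kb.
have Tp s n : T x (rcons s n) -> T x s.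
  move=> [x' [z [Cxz xx']]]; rewrite size_rcons mkseqS => /rcons_inj[zs _].
  exists x', z; split=> // r rs; apply: xx'.
  by rewrite size_rcons; exact: leqW.
have branch z : C x z <-> forall n, T x (mkseq z n).
  split=> [Cxz n|Tz]; first by exists x, z; rewrite size_mkseq.
  apply: cC => s t.
  (* A node longer than all levels of points of [s] and all indices in [t] supplies the required
     approximation. *)
  have [x' [z' []]] := Tz (\max_(i <- s) (lvl i).+1 + \max_(j <- t) j.+1)%N.
  rewrite size_mkseq => Cxz' xx' zz'; exists x', z'; split=> // a ain.
    apply: xx'; apply: leq_trans (leq_addr _ _).
    by apply: (@leq_bigmax_seq _ _ xpredT (fun i => (lvl i).+1)).
  have at' : (a < \max_(i <- s) (lvl i).+1 + \max_(j <- t) j.+1)%N.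
    apply: leq_trans (leq_addl _ _).
    by apply: (@leq_bigmax_seq _ _ xpredT S).
  by move/(congr1 (nth 0%N ^~ a)): zz'; rewrite !nth_mkseq.
have [WOx|nWOx] := pselect (WO [set r | x r]).
  have [z /branch Tz] := (CW x).1 WOx.
  by move: WOx; rewrite xT; exact: kb_branch_not_wo Tz.
apply: (nWOx); apply/CW; move: nWOx; rewrite xT => /(kb_not_wo_branch Tp)[z /branch Cxz].
by exists z.
Qed.

Lemma not_borel_WO : ~ borel WO.
Proof. by move=> /borel_analytic; exact: not_analytic_WO. Qed.

(** * Scattered sets *)

(** Quantifying over infinite subsets makes the property pass to subsets and hold vacuously for
    finite sets, which have no copy on [nat]. *)
Definition hereditarily_calB (K : set rat) :=
  forall L, L `<=` K -> infinite_set L -> in_calB WO L.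

Lemma hereditarily_calB_sub K L : L `<=` K ->
  hereditarily_calB K -> hereditarily_calB L.
Proof. by move=> LK hK M ML; apply: hK; exact: subset_trans LK. Qed.

Lemma hereditarily_calB_fin K : finite_set K -> hereditarily_calB K.
Proof. by move=> fK L /sub_finite_set/(_ fK). Qed.

Lemma hereditarily_calB_setU K L : hereditarily_calB K -> hereditarily_calB L ->
  hereditarily_calB (K `|` L).
Proof.
move=> hK hL M MKL Minf; pose p x := if x \in K then 0%N else 1%N.
have pK x : p x = 0%N -> K x by rewrite /p; case: ifPn => // /set_mem.
have pN x n : M x -> p x = n.+1 -> L x.
  by rewrite /p => /MKL[Kx|//]; rewrite mem_set.
apply: (@in_calB_sum _ _ _ p) => // [E EM|[|n]].
- split=> [WE n|Wp]; first by apply: ideal_subset WE; exact: subIsetl.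
  apply: ideal_subset (ideal_setU (Wp 0%N) (Wp 1%N)) => x Ex.
  by have [xK|xK] := boolP (x \in K); [left|right]; split=> //=;
    rewrite /p ?xK// (negbTE xK).
- by apply: hK => x [_ /pK].
- by apply: hL => x [Mx /(pN _ _ Mx)].
Qed.

(** With [r] the order or its converse, [p x] is the least code of a bound of [x] in [K]; so [p] is
    monotone, and the points of a fibre share a bound. *)
Lemma first_index (T : countType) (K : set T) (r : T -> T -> Prop) :
  (forall x, K x -> r x x) -> exists2 p : T -> nat,
    forall x, K x -> exists y, [/\ K y, r x y & p x = pickle y] &
    forall x y, K x -> K y -> r x y -> (p x <= pickle y)%N.
Proof.
move=> rK.
suff /choice[p pP] : forall x, exists n, K x ->
    (exists y, [/\ K y, r x y & n = pickle y]) /\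
    forall y, K y -> r x y -> (n <= pickle y)%N.
  by exists p => [x /pP[]//|x y /pP[_]]; apply.
move=> x; have [Kx|] := pselect (K x); last by exists 0%N.
pose P n := `[< exists y, [/\ K y, r x y & n = pickle y] >].
have exP : exists n, P n.
  by exists (pickle x); apply/asboolP; exists x; split=> //; exact: rK.
case: (ex_minnP exP) => n /asboolP Pn nmin; exists n => _; split=> // y Ky rxy.
by apply: nmin; apply/asboolP; exists y.
Qed.

(** Here [p] is nondecreasing, so its fibres follow one another upwards. The least point of a set is
    the least point of its trace on the first fibre it meets, whence a direct sum. *)
Lemma hereditarily_calB_up K :
  (forall b, K b -> hereditarily_calB (K `&` [set x | (x <= b)%O])) ->
  hereditarily_calB K.
Proof.
move=> hK L LK Linf.
have [//|p pex ple] := @first_index _ K (fun x y => (x <= y)%O).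
have pmono x y : L x -> L y -> (x <= y)%O -> (p x <= p y)%N.
  move=> /LK Kx /LK Ky xy; have [z [Kz yz ->]] := pex _ Ky.
  by apply: ple => //; exact: le_trans yz.
apply: (@in_calB_sum _ _ _ p) => // [E EL|n].
  split=> [WE n|Wp]; first by apply: ideal_subset WE; exact: subIsetl.
  move=> B BE [b Bb].
  have exP : exists n, `[< exists2 x, B x & p x = n >].
    by exists (p b); apply/asboolP; exists b.
  case: (ex_minnP exP) => n /asboolP[c Bc pc] nmin.
  have [||m [Bm pm] mlb] := Wp n (B `&` p @^-1` [set n]).
  - by move=> x [/BE].
  - by exists c.
  - exists m => // x Bx; have [xm|/ltW//] := leP x m.
    apply: mlb; split=> //=; apply/eqP; rewrite eqn_leq -{1}pm.
    rewrite pmono//; [|exact/EL/BE..].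
    by apply: nmin; apply/asboolP; exists x.
have [[x0 [Lx0 px0]] Finf|nF] := pselect ((L `&` p @^-1` [set n]) !=set0).
  have [y [Ky _ py]] := pex _ (LK _ Lx0).
  apply: (hK _ Ky) => // x [Lx px]; split; first exact: LK.
  have [z [_ xz pz]] := pex _ (LK _ Lx).
  rewrite /=; suff <- : z = y by [].
  by apply: (pcan_inj pickleK); rewrite -pz -py px px0.
by move=> /infinite_setN0.
Qed.

(** Here [p] is nonincreasing. The index of its least point bounds the indices of a well ordered
    set; conversely, under such a bound, the least point is found in the fibre of greatest index.
    This gives a bounded sum. *)
Lemma hereditarily_calB_down K :
  (forall b, K b -> hereditarily_calB (K `&` [set x | (b <= x)%O])) ->
  hereditarily_calB K.
Proof.
move=> hK L LK Linf.
have [//|p pex ple] := @first_index _ K (fun x y => (y <= x)%O).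
have pmono x y : L x -> L y -> (x <= y)%O -> (p y <= p x)%N.
  move=> /LK Kx /LK Ky xy; have [z [Kz yz ->]] := pex _ Kx.
  by apply: ple => //; exact: le_trans xy.
apply: (@in_calB_bounded_sum _ _ _ p) => // [E EL|n].
  split=> [WE|[Wp [N EN]]].
    split=> [n|]; first by apply: ideal_subset WE; exact: subIsetl.
    have [E0|nE] := pselect (E !=set0); last first.
      by exists 0%N => x Ex; case: nE; exists x.
    have [//|m Em mlb] := WE E _ E0.
    by exists (p m) => x Ex; apply: pmono; [exact: EL..|exact: mlb].
  move=> B BE [b Bb].
  have exP : exists n, `[< exists2 x, B x & p x = n >].
    by exists (p b); apply/asboolP; exists b.
  have leN n : `[< exists2 x, B x & p x = n >] -> (n <= N)%N.
    by move=> /asboolP[x /BE/EN + <-].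
  case: (ex_maxnP exP leN) => n /asboolP[c Bc pc] nmax.
  have [||m [Bm pm] mlb] := Wp n (B `&` p @^-1` [set n]).
  - by move=> x [/BE].
  - by exists c.
  - exists m => // x Bx; have [xm|/ltW//] := leP x m.
    apply: mlb; split=> //=; apply/eqP; rewrite eqn_leq -{2}pm.
    rewrite pmono ?andbT//; [|exact/EL/BE..].
    by apply: nmax; apply/asboolP; exists x.
have [[x0 [Lx0 px0]] Finf|nF] := pselect ((L `&` p @^-1` [set n]) !=set0).
  have [y [Ky _ py]] := pex _ (LK _ Lx0).
  apply: (hK _ Ky) => // x [Lx px]; split; first exact: LK.
  have [z [_ xz pz]] := pex _ (LK _ Lx).
  rewrite /=; suff <- : z = y by [].
  by apply: (pcan_inj pickleK); rewrite -pz -py px px0.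
by move=> /infinite_setN0.
Qed.

Lemma seq_extremum (T : eqType) (r : rel T) (a : T) (s : seq T) :
  total r -> transitive r ->
  exists2 m, m \in a :: s & {in a :: s, forall x, r x m}.
Proof.
move=> rtot rtr; have rr x : r x x by have := rtot x x; rewrite orbb.
elim: s a => [|b s IH] a.
  by exists a; rewrite ?mem_head// => x; rewrite inE => /eqP ->.
have [m ms mr] := IH b.
have [am|ma] := orP (rtot a m).
  exists m; first by rewrite in_cons ms orbT.
  by move=> x; rewrite in_cons => /orP[/eqP ->//|/mr].
exists a; first exact: mem_head.
by move=> x; rewrite in_cons => /orP[/eqP ->//|/mr xm]; exact: rtr ma.
Qed.

(** * Embedding the rationals along a dense relation *)

Section DenseRelation.
Variables (A : set rat) (ll : rat -> rat -> Prop).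
Hypothesis llA : forall x y, ll x y -> [/\ A x, A y & (x < y)%O].
Hypothesis ll_le : forall x y z, A x -> (x <= y)%O -> ll y z -> ll x z.
Hypothesis le_ll : forall x y z, A z -> (y <= z)%O -> ll x y -> ll x z.
Hypothesis ll_dense : forall x y, ll x y -> exists2 z, ll x z & ll z y.

Lemma ll_interpolate (a b : rat) (s t : seq rat) :
  {in a :: s & b :: t, forall x y, ll x y} ->
  exists c, {in a :: s, forall x, ll x c} /\ {in b :: t, forall y, ll c y}.
Proof.
move=> st.
have [m ms mle] := @seq_extremum _ <=%O a s le_total le_trans.
have [n nt nge] := @seq_extremum _ >=%O b t ge_total ge_trans.
have [c mc cn] := ll_dense (st _ _ ms nt).
exists c; split=> [x xs|y yt].
  have [Ax _ _] := llA (st _ _ xs nt).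
  by apply: ll_le mc => //; exact: mle.
have [_ Ay _] := llA (st _ _ ms yt).
by apply: le_ll cn => //; exact: nge.
Qed.

(* Cantor's argument, one rational at a time; s is the graph built so far. *)
Lemma dense_relation_not_scattered a b : ll a b -> ~ scattered A.
Proof.
move=> ab; rewrite /scattered notK.
(* A finite graph is [good] if its values lie between [a] and [b] for [ll] and it carries the strict
   order to [ll]. *)
pose good (s : seq (rat * rat)) :=
  (forall p, p \in s -> ll a p.2 /\ ll p.2 b) /\
  forall p q, p \in s -> q \in s -> (p.1 < q.1)%O -> ll p.2 q.2.
have ext (sx : seq (rat * rat) * rat) :
    exists c, good sx.1 -> good ((sx.2, c) :: sx.1).
  case: sx => s x; have [gs|] := pselect (good s); last by exists a.
  have [sab sll] := gs.
  have [|c [lc cu]] := @ll_interpolate a b [seq p.2 | p <- s & (p.1 < x)%O]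
      [seq p.2 | p <- s & (x < p.1)%O].
    move=> y z; rewrite !in_cons.
    move=> /orP[/eqP->|/mapP[p + ->]] /orP[/eqP->|/mapP[q + ->]] //.
    - by rewrite mem_filter => /andP[_ /sab[]].
    - by rewrite mem_filter => /andP[_ /sab[]].
    - rewrite !mem_filter => /andP[px ps] /andP[xq qs].
      by apply: sll => //; exact: lt_trans xq.
  exists c => _; split=> /=.
    move=> p; rewrite in_cons => /orP[/eqP->|/sab//] /=.
    by split; [apply: lc|apply: cu]; exact: mem_head.
  move=> p q; rewrite !in_cons => /orP[/eqP->|ps] /orP[/eqP->|qs] //=.
  - by rewrite ltxx.
  - by move=> xq; apply: cu; rewrite in_cons map_f ?orbT// mem_filter xq.
  - by move=> px; apply: lc; rewrite in_cons map_f ?orbT// mem_filter px.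
  - exact: sll.
have [c cP] := choice ext.
(* [e] lists the rationals with possible repetitions, 0 being the default. A point may thus get
   several values, which [good] allows, as it compares only distinct points. *)
pose e n : rat := odflt 0%R (unpickle n).
have eK x : e (pickle x) = x by rewrite /e pickleK.
pose g := fix g n : seq (rat * rat) :=
  if n is m.+1 then (e m, c (g m, e m)) :: g m else [::].
have gP n : good (g n) by elim: n => [|n IH]; [split|exact: (cP (_, _))].
have gS m n : {subset g m <= g (n + m)%N}.
  by elim: n => // n IH p /IH pg; rewrite addSn in_cons pg orbT.
have /choice[f fP] : forall x, exists y, (x, y) \in g (pickle x).+1.
  move=> x; exists (c (g (pickle x), x)).
  by rewrite -[in X in (X, _)](eK x) -[in X in (_, c (_, X))](eK x) mem_head.
exists f => [_ [x _ <-]|].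
  by have [/(_ _ (fP x))[/llA[]]] := gP (pickle x).+1.
apply: le_mono => x y xy.
have := (gP ((pickle y).+1 + (pickle x).+1)%N).2 (x, f x) (y, f y).
case/(_ _ _ xy)/llA => //; first exact/gS/fP.
by rewrite addnC; exact/gS/fP.
Qed.

End DenseRelation.

Lemma scattered_hereditarily_calB A : scattered A -> hereditarily_calB A.
Proof.
move=> sA; apply: contrapT => nhA.
pose itv a b := A `&` [set x | (a <= x <= b)%O].
have itv1 a : hereditarily_calB (itv a a).
  apply: hereditarily_calB_fin; apply: sub_finite_set (finite_set1 a) => x [_ /=].
  by move=> /le_anti.
pose ll a b := [/\ A a, A b, (a < b)%O & ~ hereditarily_calB (itv a b)].
suff [a [b ab]] : exists a b, ll a b.
  apply: (dense_relation_not_scattered _ _ _ _ ab sA) => {a b ab}.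
  - by move=> x y [].
  - move=> x y z Ax xy [Ay Az yz nh]; split=> //; first exact: le_lt_trans yz.
    apply: contra_not nh; apply: hereditarily_calB_sub => w [Aw /andP[yw wz]].
    by split=> //=; rewrite (le_trans xy yw).
  - move=> x y z Az yz [Ax Ay xy nh]; split=> //; first exact: lt_le_trans yz.
    apply: contra_not nh; apply: hereditarily_calB_sub => w [Aw /andP[xw wy]].
    by split=> //=; rewrite xw (le_trans wy yz).
  - move=> a b [Aa Ab ab nh]; apply: contrapT => nd; apply: nh.
    (* If no [c] splits the interval into two bad ones, it is covered by the points [c] with good
       left part, forming [L], and those with good right part, forming [U]. [L] is exhausted upwards
       and [U] downwards. *)
    pose L := itv a b `&` [set c | hereditarily_calB (itv a c)].
    pose U := itv a b `&` [set c | hereditarily_calB (itv c b)].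
    apply: (@hereditarily_calB_sub (L `|` U)).
      move=> c [Ac acb]; have /andP[] := acb.
      rewrite le_eqVlt => /orP[/eqP <- _|ac].
        by left; split; [split=> //=; rewrite lexx (ltW ab)|exact: itv1].
      rewrite le_eqVlt => /orP[/eqP ->|cb].
        by right; split; [split=> //=; rewrite lexx (ltW ab)|exact: itv1].
      have [h|nh] := pselect (hereditarily_calB (itv a c)); first by left.
      right; split=> //; apply: contrapT => nh'; apply: nd.
      by exists c; split.
    apply: hereditarily_calB_setU.
      apply: hereditarily_calB_up => c [_]; apply: hereditarily_calB_sub.
      by move=> x [[[Ax /andP[ax _]] _] xc]; split=> //=; rewrite ax.
    apply: hereditarily_calB_down => c [_]; apply: hereditarily_calB_sub.
    by move=> x [[[Ax /andP[_ xb]] _] cx]; split=> //=; rewrite xb andbT.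
(* Without bad intervals, [A] splits at any of its points [a] into a lower and an upper part, both
   exhausted by good intervals. *)
apply: contrapT => nll; apply: nhA => L LA.
have itvh a b : A a -> A b -> (a <= b)%O -> hereditarily_calB (itv a b).
  move=> Aa Ab; rewrite le_eqVlt => /orP[/eqP <-//|ab].
  by apply: contrapT => nh; apply: nll; exists a, b.
move=> Linf; have [a La] := infinite_setN0 Linf.
have Aa := LA _ La; move: L LA Linf {La}.
apply: (@hereditarily_calB_sub
    ((A `&` [set x | (x <= a)%O]) `|` (A `&` [set x | (a <= x)%O]))).
  by move=> x Ax; have [xa|/ltW ax] := leP x a; [left|right].
apply: hereditarily_calB_setU.
  apply: hereditarily_calB_down => b [Ab /= ba].
  apply: hereditarily_calB_sub (itvh _ _ Ab Aa ba).
  by move=> x [[Ax /= xa] /= bx]; split=> //=; rewrite bx.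
apply: hereditarily_calB_up => b [Ab /= ab].
apply: hereditarily_calB_sub (itvh _ _ Aa Ab ab).
by move=> x [[Ax /= ax] /= xb]; split=> //=; rewrite ax.
Qed.

(** * Copies of the rationals, and the equivalence *)

Lemma WO_image (f : rat -> rat) : {mono f : x y / (x <= y)%O} ->
  forall E, WO E <-> WO (f @` E).
Proof.
move=> fm E; split=> WE B BE [b Bb].
  have [||m Bm mlb] := WE (f @^-1` B `&` E); first exact: subIsetr.
    by have [x Ex xb] := BE _ Bb; exists x; split=> //=; rewrite xb.
  exists (f m); first by have [] := Bm.
  move=> y By; have [x Ex xy] := BE _ By; rewrite -xy fm.
  by apply: mlb; split=> //=; rewrite xy.
have [||_ [m Bm <-] mlb] := WE (f @` B); first exact: image_subset.
  by exists (f b), b.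
by exists m => // x Bx; rewrite -fm; apply: mlb; exists x.
Qed.

Lemma embeds_WO_restr (A : set rat) : ~ scattered A -> embeds WO (restr_ideal WO A).
Proof.
move=> /contrapT[f fA fm].
have fAx x : f x \in A by apply/mem_set/fA; exists x.
pose h x : A := exist _ (f x) (fAx x).
exists h => [x y /(congr1 val)/= fxy|E].
  by apply: le_anti; rewrite -(fm x y) -(fm y x) fxy lexx.
rewrite (WO_image fm) (_ : f @` E = val @` (h @` E)) // image_comp.
exact: eq_imagel.
Qed.

Theorem theorem4p13 (A : set rat) (hA : infinite_set A) :
  [<-> scattered A;
       belongs_to_calB (restr_ideal WO A);
       borel (restr_ideal WO A);
       ~ embeds WO (restr_ideal WO A)].
Proof.
tfae.
- move=> /scattered_hereditarily_calB hAB.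
  by apply: in_calB_belongs; exact: hAB.
- move=> [J /calB_borel_orth[bJ _] [f /bij_inj fI IJ]].
  by apply: borel_embeds bJ; exists f.
- by move=> bA /borel_embeds/(_ bA); exact: not_borel_WO.
- by apply: contra_notP => /embeds_WO_restr.
Qed.
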